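(* Let $M^7$ be a contact Calabi--Yau manifold with contact form $\theta$, transverse Calabi--Yau structure $(\omega,\Upsilon)$, and Reeb vector field $\xi$ with compact orbits, and let $N=M/\langle\xi\rangle$. Let $h:M\to\mathbb{R}_{\ge 0}$ be a $\xi$-invariant continuous function which vanishes exactly over a non-empty discrete set of points $S\subset N$ and is smooth and positive elsewhere, and let $$\varphi=h\,\theta\wedge\omega+\mathrm{Re}\Upsilon$$ be the associated $\mathrm{G}_2$-structure on the set $\{h>0\}$ (so that the circle fibres collapse at the isolated points of $S$). Then the torsion of $\varphi$ is not bounded on $\{h>0\}$, with respect to the metric induced by $\varphi$. In other words, contact Calabi--Yau manifolds do not admit $S^1$-invariant $\mathrm{G}_2$-structures with bounded torsion, compatible with the transverse Calabi--Yau structure, and with fibres collapsing at isolated points.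
   Context: A contact Calabi--Yau manifold is a 7-manifold $M$ with a nowhere-vanishing 1-form $\theta$ and a transverse torsion-free $\mathrm{SU}(3)$-structure $(\omega,\Upsilon)$ on $\ker\theta$ with $d\theta=\omega$, $d\omega=0$, $d\Upsilon=0$; here $\omega\wedge\Upsilon=0$, $\frac16\omega^3=\frac14\mathrm{Re}\Upsilon\wedge\mathrm{Im}\Upsilon$. The Reeb vector field $\xi$ satisfies $\theta(\xi)=1$, $\mathcal{L}_\xi\theta=0$, and $\omega,\Upsilon$ are basic (annihilated by $\xi\lrcorner$ and $\mathcal{L}_\xi$). When Reeb orbits are compact, the leaf space $N$ is a Riemannian orbifold with the metric $g_{CY}$ induced by $(\omega,\Upsilon)$. An $S^1$-invariant $\mathrm{G}_2$-structure compatible with the transverse Calabi--Yau structure is one of the form $\varphi=h\theta\wedge\omega+\mathrm{Re}\Upsilon$, $*\varphi=\frac12\omega^2-h\theta\wedge\mathrm{Im}\Upsilon$ with $\xi(h)=0$; it induces the metric $g=g_{CY}+h^2\theta^2$, so that $h$ is (up to a constant) the length of the fibres. The torsion of a $\mathrm{G}_2$-structure is the quadruple $(\tau_1,\tau_7,\tau_{14},\tau_{27})$, with $\tau_1$ a function, $\tau_7$ a 1-form, $\tau_{14}$ a 2-form satisfying $*\tau_{14}=-\tau_{14}\wedge\varphi$, and $\tau_{27}$ a 3-form satisfying $\tau_{27}\wedge\varphi=0=\tau_{27}\wedge*\varphi$, determined by $d\varphi=\tau_1*\varphi+3\tau_7\wedge\varphi+*\tau_{27}$ and $d{*\varphi}=4\tau_7\wedge*\varphi+*\tau_{14}$.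 The torsion is bounded if the pointwise norms of all components are bounded. *)

(* Defs.v *)
(* MathComp / MathComp-Analysis *)
From HB Require Import structures.
From mathcomp Require Import all_boot all_order all_algebra all_fingroup.
From mathcomp Require Import generic_quotient.
From mathcomp Require Import all_classical all_reals all_analysis.
Set Implicit Arguments.
Unset Strict Implicit.
Unset Printing Implicit Defensive.
Import Order.TTheory GRing.Theory Num.Theory.
Import numFieldNormedType.Exports.
Local Open Scope classical_set_scope.
Local Open Scope ring_scope.

Section Smooth.
Context {R : realType} {V W : normedModType R}.

(* The directional derivatives 'D_v f are the coordinates of Df, so for a
   finite-dimensional V this is the usual inductive definition of C^n. *)
Fixpoint Cn_on (n : nat) (U : set V) (f : V -> W) : Prop :=
  match n with
  | 0 => forall x, U x -> {for x, continuous f}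
  | n'.+1 => (forall x, U x -> differentiable f x) /\
             (forall v : V, Cn_on n' U (fun x => 'D_v f x))
  end.

Definition smooth_on (U : set V) (f : V -> W) := forall n, Cn_on n U f.

End Smooth.

Section LinearAlgebra.
Context {R : realType}.
Local Notation V := 'rV[R]_7.

(* Exterior algebra of R^7: k-covectors are functions of k vectors; being
   multilinear and alternating is the predicate [alternating_covec]. *)
Definition covec (k : nat) := ('I_k -> V) -> R.

Definition alternating_covec k (a : covec k) : Prop :=
  (forall (i : 'I_k) (v : 'I_k -> V) (t : R) (x y : V),
     a [eta v with i |-> t *: x + y] =
     t * a [eta v with i |-> x] + a [eta v with i |-> y]) /\
  (forall (i j : 'I_k) (v : 'I_k -> V), i != j -> v i = v j -> a v = 0).

(* normalised so that (dx_1 /\ ... /\ dx_k)(e_1, ..., e_k) = 1 *)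
Definition ext_wedge k l (a : covec k) (b : covec l) : covec (k + l) := fun v =>
  ((k`! * l`!)%N%:R)^-1 *
  \sum_(s : 'S_(k + l)) (-1) ^+ s *
     a (fun i => v (s (lshift l i))) * b (fun j => v (s (rshift k j))).

Definition contract k (x : V) (a : covec k.+1) : covec k := fun v =>
  a (fun i => if unlift ord0 i is Some j then v j else x).

(* dx [:: i1; ...; ik] : covec k is dx_i1 /\ ... /\ dx_ik,
   with coordinates x_0, ..., x_6 on R^7. *)
Definition dx k (I : seq nat) : covec k := fun v =>
  \det (\matrix_(a < k, b < k) v a ord0 (inord (nth 0%N I b))).

(* R^7 = R + C^3, with z_j = x_(2j-1) + i x_(2j):
   omega0 = (i/2) sum_j dz_j /\ d(bar z_j) and Upsilon0 = dz_1 /\ dz_2 /\ dz_3. *)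
Definition theta0 : covec 1 := dx [:: 0]%N.
Definition omega0 : covec 2 := fun v =>
  dx [:: 1; 2]%N v + dx [:: 3; 4]%N v + dx [:: 5; 6]%N v.
Definition ReUpsilon0 : covec 3 := fun v =>
  dx [:: 1; 3; 5]%N v - dx [:: 1; 4; 6]%N v
  - dx [:: 2; 3; 6]%N v - dx [:: 2; 4; 5]%N v.
Definition ImUpsilon0 : covec 3 := fun v =>
  dx [:: 1; 3; 6]%N v + dx [:: 1; 4; 5]%N v
  + dx [:: 2; 3; 5]%N v - dx [:: 2; 4; 6]%N v.

Definition phi0 : covec 3 := fun v => ext_wedge theta0 omega0 v + ReUpsilon0 v.

(* A frame e_0, ..., e_6 is the matrix E with rows e_i; v |-> v *m E is the
   linear map sending the standard basis to the frame. *)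
Definition pullback k (E : 'M[R]_7) (a : covec k) : covec k :=
  fun v => a (fun i => v i *m E).

Definition SU3_frame (t : covec 1) (w : covec 2) (r m : covec 3)
    (E : 'M[R]_7) :=
  [/\ E \in unitmx, pullback E t = theta0, pullback E w = omega0,
      pullback E r = ReUpsilon0 & pullback E m = ImUpsilon0].

(* The stabiliser of phi0 in GL(7) is G2, a subgroup of SO(7): the metric and
   the orientation induced by a G2-form f are those for which all the frames
   below are orthonormal and positive. *)
Definition G2_frame (f : covec 3) (E : 'M[R]_7) :=
  E \in unitmx /\ pullback E f = phi0.

(* Hodge star of the metric and orientation for which E is orthonormal and
   positive: *(e^s(0) ... e^s(k-1)) = sgn(s) e^s(k) ... e^s(6), where the
   dual coframe is read off as e^i(v) = (v *m E^-1)_i. *)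
Definition hodge (E : 'M[R]_7) k (a : covec k) : covec (7 - k) := fun v =>
  (k`!%:R)^-1 *
  \sum_(s : 'S_7) (-1) ^+ s * a (fun i => row (s (inord i)) E) *
     \prod_(j < 7 - k) (v j *m invmx E) ord0 (s (inord (k + j))).

(* norm for the metric for which E is orthonormal; |e^i1 ... e^ik| = 1 *)
Definition frame_norm (E : 'M[R]_7) k (a : covec k) : R :=
  Num.sqrt ((k`!%:R)^-1 *
            \sum_(i : {ffun 'I_k -> 'I_7}) (a (fun j => row (i j) E)) ^+ 2).

End LinearAlgebra.

(* Smooth 7-manifolds, given by an atlas; [crd c] and [icrd c] are only
   meaningful on [chart_dom c] and on its image. *)
Record manifold7 (R : realType) := Manifold7 {
  carrier :> topologicalType;
  chart : Type;
  chart_dom : chart -> set carrier;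
  crd : chart -> carrier -> 'rV[R]_7;
  icrd : chart -> 'rV[R]_7 -> carrier;
  manifold_hausdorff : hausdorff_space carrier;
  manifold_second_countable : @second_countable carrier;
  chart_cover : forall p, exists c, chart_dom c p;
  dom_open : forall c, open (chart_dom c);
  img_open : forall c, open (crd c @` chart_dom c);
  crdK : forall c p, chart_dom c p -> icrd c (crd c p) = p;
  crd_continuous : forall c p, chart_dom c p -> {for p, continuous (crd c)};
  icrd_continuous : forall c p, chart_dom c p ->
    {for crd c p, continuous (icrd c)};
  transition_smooth : forall c c',
    smooth_on (crd c @` (chart_dom c `&` chart_dom c')) (crd c' \o icrd c)
}.

Arguments chart_dom {R m}.
Arguments crd {R m}.
Arguments icrd {R m}.

Section Calculus.
Context {R : realType} (M : manifold7 R).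
Local Notation V := 'rV[R]_7.

(* A differential k-form (resp. vector field) is given at each point by its
   expression in each chart around this point. *)
Definition kform (k : nat) := chart M -> M -> covec (R := R) k.
Definition vfield := chart M -> M -> V.

Definition smooth_fun (W : set M) (f : M -> R) :=
  forall c, smooth_on (crd c @` (chart_dom c `&` W)) (f \o icrd c).

Definition transition (c c' : chart M) (p : M) : V -> V :=
  'd (crd c' \o icrd c) (crd c p).

(* smooth k-forms on an open set W; values outside W are irrelevant *)
Definition is_form (W : set M) k (a : kform k) : Prop :=
  [/\ forall c p, W p -> chart_dom c p -> alternating_covec (a c p),
      forall c c' p, W p -> chart_dom c p -> chart_dom c' p ->
        forall v, a c p v = a c' p (fun i => transition c c' p (v i))
    & forall c v,
        smooth_on (crd c @` (chart_dom c `&` W)) (fun x => a c (icrd c x) v)].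

Definition is_vfield (X : vfield) : Prop :=
  (forall c c' p, chart_dom c p -> chart_dom c' p -> X c' p = transition c c' p (X c p)) /\
  (forall c, smooth_on (crd c @` chart_dom c) (fun x => X c (icrd c x))).

(* In [ext_d] and [Lie] the arguments v are constant vector fields in the
   chart, hence there are no terms in [v_i, v_j]. *)
Definition ext_d k (a : kform k) : kform k.+1 := fun c p v =>
  \sum_(i < k.+1) (-1) ^+ i *
    'D_(v i) (fun x => a c (icrd c x) (fun j => v (lift i j))) (crd c p).

(* (L_X a)(v) = X(a(v)) - sum_i a(.., [X, v_i], ..) and [X, v_i] = - D_{v_i} X *)
Definition Lie k (X : vfield) (a : kform k) : kform k := fun c p v =>
  'D_(X c p) (fun x => a c (icrd c x) v) (crd c p) +
  \sum_(i < k) a c p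
    [eta v with i |-> 'D_(v i) (fun x => X c (icrd c x)) (crd c p)].

Definition basic k (X : vfield) (a : kform k.+1) : Prop :=
  forall c p, chart_dom c p ->
    (forall v, contract (X c p) (a c p) v = 0) /\
    (forall v, Lie X a c p v = 0).

(* Upsilon = ReU + i ImU. The fields ccy_omega_ReU, ccy_omega_ImU and ccy_volume
   follow from ccy_SU3. *)
Record contact_calabi_yau (theta : kform 1) (omega : kform 2)
    (ReU ImU : kform 3) : Prop := {
  ccy_theta_form : is_form setT theta;
  ccy_omega_form : is_form setT omega;
  ccy_ReU_form : is_form setT ReU;
  ccy_ImU_form : is_form setT ImU;
  ccy_theta_neq0 : forall c p, chart_dom c p -> exists v, theta c p v <> 0;
  ccy_SU3 : forall c p, chart_dom c p ->
    exists E, SU3_frame (theta c p) (omega c p) (ReU c p) (ImU c p) E;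
  ccy_omega_ReU : forall c p, chart_dom c p -> forall v,
    ext_wedge (omega c p) (ReU c p) v = 0;
  ccy_omega_ImU : forall c p, chart_dom c p -> forall v,
    ext_wedge (omega c p) (ImU c p) v = 0;
  ccy_volume : forall c p, chart_dom c p -> forall v : 'I_6 -> V,
    6%:R^-1 * ext_wedge (ext_wedge (omega c p) (omega c p)) (omega c p) v =
    4%:R^-1 * ext_wedge (ReU c p) (ImU c p) v;
  ccy_dtheta : forall c p, chart_dom c p -> forall v, ext_d theta c p v = omega c p v;
  ccy_domega : forall c p, chart_dom c p -> forall v, ext_d omega c p v = 0;
  ccy_dReU : forall c p, chart_dom c p -> forall v, ext_d ReU c p v = 0;
  ccy_dImU : forall c p, chart_dom c p -> forall v, ext_d ImU c p v = 0 }.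

Record reeb (theta : kform 1) (omega : kform 2) (ReU ImU : kform 3)
    (xi : vfield) : Prop := {
  reeb_vfield : is_vfield xi;
  reeb_theta : forall c p, chart_dom c p -> theta c p (fun=> xi c p) = 1;
  reeb_Lie : forall c p, chart_dom c p -> forall v, Lie xi theta c p v = 0;
  reeb_omega : basic xi omega;
  reeb_ReU : basic xi ReU;
  reeb_ImU : basic xi ImU }.

Definition integral_curve (X : vfield) (gamma : R -> M) : Prop :=
  continuous gamma /\
  (forall t c, chart_dom c (gamma t) ->
     is_derive t (1 : R) (crd c \o gamma) (X c (gamma t))).

Record flow := Flow {
  flow_fun :> R -> M -> M;
  flow0 : forall p, flow_fun 0 p = p;
  flowD : forall s t p, flow_fun (s + t) p = flow_fun s (flow_fun t p) }.

(* flow defined for all times, i.e. the vector field is complete *)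
Definition flow_of (X : vfield) (Phi : flow) : Prop :=
  forall p, integral_curve X (fun t => Phi t p).

Definition flow_orbit (Phi : flow) (p : M) : set M := range (fun t => Phi t p).

Section LeafSpace.
Variable Phi : flow.

Definition same_leaf : rel M := fun p q => `[< flow_orbit Phi p q >].

Lemma same_leaf_refl : reflexive same_leaf.
Proof. by move=> p; apply/asboolP; exists 0; rewrite ?flow0. Qed.

Lemma same_leaf_sym : symmetric same_leaf.
Proof.
have S p q : same_leaf p q -> same_leaf q p.
  move=> /asboolP[t _ <-]; apply/asboolP; exists (- t) => //.
  by rewrite -flowD addNr flow0.
by move=> p q; apply/idP/idP; exact: S.
Qed.

Lemma same_leaf_trans : transitive same_leaf.
Proof.
move=> q p r /asboolP[s _ <-] /asboolP[t _ <-]; apply/asboolP.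
by exists (t + s) => //; rewrite flowD.
Qed.

Definition same_leaf_equiv :=
  EquivRel same_leaf same_leaf_refl same_leaf_sym same_leaf_trans.

Definition leaf_space : topologicalType :=
  quotient_topology {eq_quot same_leaf_equiv}%qT.

Definition leaf (p : M) : leaf_space :=
  (\pi_(quotient_topology {eq_quot same_leaf_equiv}%qT) p)%qT.

End LeafSpace.

(* phi = h theta /\ omega + Re Upsilon and
   *phi = omega^2 / 2 - h theta /\ Im Upsilon *)
Definition ccy_phi (h : M -> R) (theta : kform 1) (omega : kform 2)
    (ReU : kform 3) : kform 3 := fun c p v =>
  h p * ext_wedge (theta c p) (omega c p) v + ReU c p v.

Definition ccy_starphi (h : M -> R) (theta : kform 1) (omega : kform 2)
    (ImU : kform 3) : kform 4 := fun c p v =>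
  2%:R^-1 * ext_wedge (omega c p) (omega c p) v
  - h p * ext_wedge (theta c p) (ImU c p) v.

(* (t1, t7, t14, t27) is the torsion of the G2-structure phi on the open set W,
   psi being the form *phi. The conditions quantified over the G2-frames E do not
   depend on E. *)
Record G2_torsion (W : set M) (phi : kform 3) (psi : kform 4)
    (t1 : M -> R) (t7 : kform 1) (t14 : kform 2) (t27 : kform 3) : Prop := {
  tor_phi_form : is_form W phi;
  tor_psi : forall c p E, W p -> chart_dom c p -> G2_frame (phi c p) E ->
    forall v, psi c p v = hodge E (phi c p) v;
  tor_t1_smooth : smooth_fun W t1;
  tor_t7_form : is_form W t7;
  tor_t14_form : is_form W t14;
  tor_t27_form : is_form W t27;
  tor_t14_type : forall c p E, W p -> chart_dom c p -> G2_frame (phi c p) E ->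
    forall v, hodge E (t14 c p) v = - ext_wedge (t14 c p) (phi c p) v;
  tor_t27_phi : forall c p, W p -> chart_dom c p ->
    forall v, ext_wedge (t27 c p) (phi c p) v = 0;
  tor_t27_psi : forall c p, W p -> chart_dom c p ->
    forall v, ext_wedge (t27 c p) (psi c p) v = 0;
  tor_dphi : forall c p E, W p -> chart_dom c p -> G2_frame (phi c p) E ->
    forall v, ext_d phi c p v =
      t1 p * psi c p v + 3%:R * ext_wedge (t7 c p) (phi c p) v
      + hodge E (t27 c p) v;
  tor_dpsi : forall c p E, W p -> chart_dom c p -> G2_frame (phi c p) E ->
    forall v, ext_d psi c p v =
      4%:R * ext_wedge (t7 c p) (psi c p) v + hodge E (t14 c p) v }.

Definition bounded_torsion (W : set M) (phi : kform 3)
    (t1 : M -> R) (t7 : kform 1) (t14 : kform 2) (t27 : kform 3) : Prop :=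
  exists C : R, forall c p E, W p -> chart_dom c p -> G2_frame (phi c p) E ->
    [/\ `|t1 p| <= C, frame_norm E (t7 c p) <= C,
        frame_norm E (t14 c p) <= C & frame_norm E (t27 c p) <= C].

End Calculus.

(* Main.v *)
Require Import Defs.
From HB Require Import structures.
From mathcomp Require Import all_boot all_order all_algebra all_fingroup.
From mathcomp Require Import generic_quotient.
From mathcomp Require Import all_classical all_reals all_analysis.
From mathcomp Require Import ring lra.
Import Order.TTheory GRing.Theory Num.Theory.
Import numFieldNormedType.Exports.
Local Open Scope classical_set_scope.
Local Open Scope ring_scope.
Set Implicit Arguments.
Unset Strict Implicit.
Unset Printing Implicit Defensive.

(* If the torsion is bounded, then so is the 4-form
   d phi = dh /\ theta /\ omega + h omega^2 on orthonormal frames; evaluated on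
   (e_i, xi / h, e_j, e_k) with e_i, e_j, e_k horizontal, omega(e_j, e_k) = 1 and
   omega(e_i, e_j) = omega(e_i, e_k) = 0, it is dh(e_i) / h. As dh(xi) = 0, the
   function log h is locally Lipschitz on {h > 0} up to the zeros of h, for the metric
   g_CY + theta^2, which does not depend on h: hence h cannot vanish at the end of a
   segment on which it is positive. Such a segment exists in a chart around any fibre
   over S: otherwise h would vanish near this fibre and, S being discrete, a single
   Reeb orbit would contain an open set. *)

Local Notation "x `_[ i ]" := (x ord0 (inord i)) (at level 3, format "x `_[ i ]").

(** * Linear algebra of the model forms on R^7 and of their frames *)

Section Covectors.
Context {R : realType}.
Local Notation V := 'rV[R]_7.
Implicit Types (E : 'M[R]_7) (x y z u v w : V).

(** Arguments are kept as lists so that explicit tuples compute; the default [0] is reached only by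
    a list shorter than [k]. *)
Definition vecs k (s : seq V) : 'I_k -> V := fun i => nth 0 s i.
Arguments vecs : clear implicits.

Lemma vecs1 (v : 'I_1 -> V) : v = vecs 1 [:: v ord0].
Proof. by apply/funext => i; rewrite ord1. Qed.

Lemma vecs2 (v : 'I_2 -> V) : v = vecs 2 [:: v ord0; v (lift ord0 ord0)].
Proof.
by apply/funext; case=> [[|[|//]] ?]; rewrite /vecs /=; congr v; apply/val_inj.
Qed.

Lemma vecs3 (v : 'I_3 -> V) :
  v = vecs 3 [:: v ord0; v (lift ord0 ord0); v (lift ord0 (lift ord0 ord0))].
Proof.
by apply/funext; case=> [[|[|[|//]]] ?]; rewrite /vecs /=; congr v; apply/val_inj.
Qed.

Lemma dx1E i x : dx [:: i] (vecs 1 [:: x]) = x`_[i].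
Proof. by rewrite /dx det_mx11 mxE. Qed.

Lemma dx2E i j x y :
  dx [:: i; j] (vecs 2 [:: x; y]) = x`_[i] * y`_[j] - x`_[j] * y`_[i].
Proof.
rewrite /dx (expand_det_row _ ord0) !big_ord_recl big_ord0 /cofactor !det_mx11.
by rewrite !mxE /vecs /= /bump /=; ring.
Qed.

Lemma dx3E i j k x y z :
  dx [:: i; j; k] (vecs 3 [:: x; y; z]) =
  x`_[i] * (y`_[j] * z`_[k] - y`_[k] * z`_[j])
  - x`_[j] * (y`_[i] * z`_[k] - y`_[k] * z`_[i])
  + x`_[k] * (y`_[i] * z`_[j] - y`_[j] * z`_[i]).
Proof.
rewrite /dx (expand_det_row _ ord0) !big_ord_recl big_ord0 /cofactor.
rewrite !(expand_det_row _ ord0) !big_ord_recl !big_ord0 /cofactor !det_mx11.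
by rewrite !mxE /vecs /= /bump /=; ring.
Qed.

Lemma theta0E x : theta0 (vecs 1 [:: x]) = x`_[0].
Proof. exact: dx1E. Qed.

Lemma omega0E x y : omega0 (vecs 2 [:: x; y]) =
  (x`_[1] * y`_[2] - x`_[2] * y`_[1]) + (x`_[3] * y`_[4] - x`_[4] * y`_[3])
  + (x`_[5] * y`_[6] - x`_[6] * y`_[5]).
Proof. by rewrite /omega0 !dx2E. Qed.

(** Two expansions of one determinant, with rows [f], [g], [k]: Leibniz formula and Laplace
    expansion along the first row. *)
Lemma sum_perm3 (f g k : 'I_3 -> R) (i0 := ord0) (i1 := lift ord0 ord0)
    (i2 := lift ord0 (lift ord0 ord0)) :
  \sum_(s : 'S_3) (-1) ^+ s * (f (s i0) * g (s i1) * k (s i2)) =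
  f i0 * (g i1 * k i2 - g i2 * k i1) - f i1 * (g i0 * k i2 - g i2 * k i0)
  + f i2 * (g i0 * k i1 - g i1 * k i0).
Proof.
pose A := \matrix_(i < 3, j < 3) nth 0 [:: f j; g j; k j] i.
transitivity (\det A).
  apply: eq_bigr => s _; congr (_ * _).
  by rewrite !big_ord_recl big_ord0 !mxE /= mulr1 mulrA.
rewrite (expand_det_row _ ord0) !big_ord_recl big_ord0 /cofactor.
rewrite !(expand_det_row _ ord0) !big_ord_recl !big_ord0 /cofactor !det_mx11.
rewrite !mxE /= -/i0 -/i1 -/i2.
have -> : lift (lift ord0 ord0) 0 = ord0 :> 'I_2 by apply/val_inj.
rewrite -/i1.
have -> : lift i1 ord0 = i0 by apply/val_inj.
have -> : lift i1 (lift ord0 ord0) = i2 by apply/val_inj.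
have -> : lift i2 ord0 = i0 by apply/val_inj.
have -> : lift i2 (lift ord0 ord0) = i1 by apply/val_inj.
by rewrite /bump /=; ring.
Qed.

Lemma wedge_theta0_omega0 x y z :
  ext_wedge theta0 omega0 (vecs 3 [:: x; y; z]) =
  theta0 (vecs 1 [:: x]) * omega0 (vecs 2 [:: y; z])
  - theta0 (vecs 1 [:: y]) * omega0 (vecs 2 [:: x; z])
  + theta0 (vecs 1 [:: z]) * omega0 (vecs 2 [:: x; y]).
Proof.
pose v := vecs 3 [:: x; y; z].
pose c n (i : 'I_3) := (v i)`_[n].
(* The sum over permutations of [d p q] is the determinant of the coordinates 0, p, q. Each of the
   three terms of [omega0] gives two opposite determinants, which the factor 1/2 compensates. *)
pose d p q (s : 'S_3) := (-1) ^+ s *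
  (c 0 (s ord0) * c p (s (lift ord0 ord0)) * c q (s (lift ord0 (lift ord0 ord0)))).
have -> : ext_wedge theta0 omega0 v = 2^-1 *
   (\sum_s d 1 2 s - \sum_s d 2 1 s + (\sum_s d 3 4 s - \sum_s d 4 3 s)
    + (\sum_s d 5 6 s - \sum_s d 6 5 s)).
  rewrite -!sumrB -!big_split /ext_wedge /=; congr (_ * _).
  apply: eq_bigr => s _; rewrite (vecs1 (fun i => _)) (vecs2 (fun i => _)).
  rewrite theta0E omega0E /d /c.
  have -> : lshift 2 ord0 = ord0 :> 'I_(1 + 2) by apply/val_inj.
  have -> : rshift 1 ord0 = lift ord0 ord0 :> 'I_(1 + 2) by apply/val_inj.
  have -> : rshift 1 (lift ord0 ord0) = lift ord0 (lift ord0 ord0) :> 'I_(1 + 2).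
    by apply/val_inj.
  by move: ((-1) ^+ s) (v _) (v _) (v _) => e x1 x2 x3; ring.
rewrite /d !sum_perm3 !theta0E !omega0E /c /v /vecs /=.
by field.
Qed.

(** Multiplication by i on C^3, with z_j = x_(2j-1) + i x_(2j), extended by 0 along x_0. *)
Definition cplxJ (v : V) : V :=
  \row_i nth 0 [:: 0; - v`_[2]; v`_[1]; - v`_[4]; v`_[3]; - v`_[6]; v`_[5]] i.

Lemma cplxJE v k : (k < 7)%N -> (cplxJ v)`_[k] =
  nth 0 [:: 0; - v`_[2]; v`_[1]; - v`_[4]; v`_[3]; - v`_[6]; v`_[5]] k.
Proof. by move=> k7; rewrite mxE inordK. Qed.

Lemma theta0_cplxJ v : theta0 (vecs 1 [:: cplxJ v]) = 0.
Proof. by rewrite theta0E cplxJE. Qed.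

Lemma omega0_cplxJ v : omega0 (vecs 2 [:: v; cplxJ v]) =
  v`_[1] ^+ 2 + v`_[2] ^+ 2 + v`_[3] ^+ 2 + v`_[4] ^+ 2 + v`_[5] ^+ 2 + v`_[6] ^+ 2.
Proof. by rewrite omega0E !cplxJE //=; ring. Qed.

(** Upsilon0 is complex linear in each argument, and Re (i z) = - Im z. *)
Lemma ReUpsilon0_cplxJ x y z : ReUpsilon0 (vecs 3 [:: cplxJ x; y; z]) =
  - ImUpsilon0 (vecs 3 [:: x; y; z]).
Proof. by rewrite /ReUpsilon0 /ImUpsilon0 !dx3E !cplxJE //=; ring. Qed.

Definition std i : V := delta_mx 0 (inord i).

Lemma stdE i j : (i < 7)%N -> (j < 7)%N -> (std i)`_[j] = (i == j)%:R.
Proof.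
by move=> i7 j7; rewrite mxE eqxx -val_eqE /= !inordK // eq_sym.
Qed.

Lemma std_mul i E : std i *m E = row (inord i) E.
Proof. by rewrite rowE. Qed.

(** Each index from 1 to 6 occurs in two monomials of [ReUpsilon0]; inserting the basis vectors of
    the other two indices of such a monomial isolates the coordinate up to sign. *)
Lemma coord_ReUpsilon0 (x : V) i : (0 < i < 7)%N -> exists j k,
  `|x`_[i]| = `|ReUpsilon0 (vecs 3 [:: x; std j; std k])|.
Proof.
move=> ilt.
have : exists j k, x`_[i] = ReUpsilon0 (vecs 3 [:: x; std j; std k]) \/
                   x`_[i] = - ReUpsilon0 (vecs 3 [:: x; std j; std k]).
  move: i ilt => [|[|[|[|[|[|[|//]]]]]]] // _;
    [exists 3%N, 5%N; left|exists 3%N, 6%N; right|exists 1%N, 5%N; right|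
     exists 1%N, 6%N; left|exists 1%N, 3%N; left|exists 1%N, 4%N; right];
    by rewrite /ReUpsilon0 !dx3E !stdE //=; ring.
by move=> [j [k [->|->]]]; exists j, k; rewrite ?normrN.
Qed.

Lemma pullbackK E k (a a0 : covec k) :
  E \in unitmx -> pullback E a = a0 -> a = pullback (invmx E) a0.
Proof.
move=> uE <-; apply/funext => v; rewrite /pullback; congr a.
by apply/funext => i; rewrite mulmxKV.
Qed.

Lemma pullback_vecs E k (a : covec k) s : size s = k ->
  pullback E a (vecs k s) = a (vecs k [seq v *m E | v <- s]).
Proof.
move=> sk; rewrite /pullback; congr a; apply/funext => i.
by rewrite /vecs (nth_map 0) ?sk.
Qed.

Definition diag_head (s : R) : 'M[R]_7 := diag_mx (\row_i if i == ord0 then s else 1).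

Lemma diag_headE s (v : V) i : (i < 7)%N ->
  (v *m diag_head s)`_[i] = if i == 0%N then v`_[i] * s else v`_[i].
Proof.
move=> i7; rewrite mul_mx_diag !mxE -val_eqE /= inordK //.
by case: ifP; rewrite ?mulr1.
Qed.

Lemma diag_head_unit s : s != 0 -> diag_head s \in unitmx.
Proof.
move=> s0; rewrite unitmxE det_diag unitfE; apply/prodf_neq0 => i _.
by rewrite mxE; case: ifP; rewrite ?oner_neq0.
Qed.

(** Dividing the first vector of an SU(3)-frame by [s] normalises [s t] in place of [t] and leaves
    the horizontal forms in model position. *)
Lemma SU3_frame_G2 (t : covec 1) (w : covec 2) (r m : covec 3) E s :
  0 < s -> SU3_frame t w r m E ->
  G2_frame (fun v : 'I_3 -> V => s * ext_wedge t w v + r v) (diag_head s^-1 *m E).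
Proof.
move=> s0 [uE /(pullbackK uE) -> /(pullbackK uE) -> /(pullbackK uE) -> _].
split; first by rewrite unitmx_mul uE diag_head_unit ?invr_eq0 ?gt_eqF.
apply/funext => v; rewrite (vecs3 v); move: (v _) (v _) (v _) => x y z.
rewrite pullback_vecs //=; set D := diag_head _.
have -> (u : 'I_3 -> V) :
  ext_wedge (pullback (invmx E) theta0) (pullback (invmx E) omega0) u =
  pullback (invmx E) (ext_wedge theta0 omega0) u by [].
rewrite !pullback_vecs //= !mulmxA !mulmxK // /phi0.
rewrite !wedge_theta0_omega0 !theta0E !omega0E /ReUpsilon0 !dx3E !diag_headE //=.
by field; rewrite gt_eqF.
Qed.

Lemma row0_diag_head s E : row ord0 (diag_head s *m E) = s *: row ord0 E.
Proof.
by apply/rowP => j; rewrite mul_diag_mx !mxE.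
Qed.

Lemma rowS_diag_head s E i : i != ord0 -> row i (diag_head s *m E) = row i E.
Proof.
by move=> i0; apply/rowP => j; rewrite mul_diag_mx !mxE (negPf i0) mul1r.
Qed.

(** Pairing with each horizontal basis vector kills the conjugate coordinate of [x]; so the kernel
    of [w] is the line of the first frame vector, and [t] fixes the scale. *)
Lemma reeb_row (t : covec 1) (w : covec 2) (r m : covec 3) E x :
  SU3_frame t w r m E -> t (vecs 1 [:: x]) = 1 ->
  (forall y, w (vecs 2 [:: x; y]) = 0) -> x = row ord0 E.
Proof.
move=> [uE /(pullbackK uE) -> /(pullbackK uE) -> _ _].
rewrite pullback_vecs //= theta0E => x0 wx.
suff : x *m invmx E = std 0.
  move/(congr1 (mulmx^~ E)); rewrite mulmxKV // std_mul => ->.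
  by congr row; apply/val_inj; rewrite /= inordK.
have {}wx y : omega0 (vecs 2 [:: x *m invmx E; y]) = 0.
  by have := wx (y *m E); rewrite pullback_vecs //= mulmxK.
have H i : (i < 7)%N -> (x *m invmx E)`_[i] = (std 0)`_[i].
  have W j := wx (std j); move: i.
  move=> [|[|[|[|[|[|[|//]]]]]]] // _; rewrite stdE //=.
  - by have := W 2%N; rewrite omega0E !stdE //=; lra.
  - by have := W 1%N; rewrite omega0E !stdE //=; lra.
  - by have := W 4%N; rewrite omega0E !stdE //=; lra.
  - by have := W 3%N; rewrite omega0E !stdE //=; lra.
  - by have := W 6%N; rewrite omega0E !stdE //=; lra.
  - by have := W 5%N; rewrite omega0E !stdE //=; lra.
by apply/rowP => i; have := H i (ltn_ord i); rewrite inord_val.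
Qed.

Lemma ext_wedge_le k l (a : covec k) (b : covec l) (v : 'I_(k + l) -> V) A B :
  (forall f : 'I_k -> 'I_(k + l), `|a (v \o f)| <= A) ->
  (forall f : 'I_l -> 'I_(k + l), `|b (v \o f)| <= B) ->
  `|ext_wedge a b v| <= (k + l)`!%:R * (A * B).
Proof.
move=> aA bB.
have A0 : 0 <= A by apply: le_trans (aA (lshift l)).
have B0 : 0 <= B by apply: le_trans (bB (@rshift k l)).
rewrite /ext_wedge normrM -[leRHS]mul1r ler_pM //.
  rewrite ger0_norm ?invr_ge0 ?ler0n // invf_le1 ?ltr0n ?muln_gt0 ?fact_gt0 //.
  by rewrite ler1n muln_gt0 !fact_gt0.
apply: le_trans (ler_norm_sum _ _ _) _.
apply: le_trans (_ : \sum_(s : 'S_(k + l)) A * B <= _).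
  apply: ler_sum => s _; rewrite !normrM normrX normrN1 expr1n mul1r.
  by rewrite ler_pM // ?aA ?bB.
by rewrite sumr_const card_Sn mulr_natl.
Qed.

Lemma hodge_le k (a : covec k) E (w : 'I_(7 - k) -> 'I_7) A :
  E \in unitmx -> (forall f : 'I_k -> 'I_7, `|a (fun i => row (f i) E)| <= A) ->
  `|hodge E a (fun j => row (w j) E)| <= 7`!%:R * A.
Proof.
move=> uE aA.
have A0 : 0 <= A by apply: le_trans (aA (fun=> ord0)).
rewrite /hodge normrM -[leRHS]mul1r ler_pM //.
  by rewrite ger0_norm ?invr_ge0 ?ler0n // invf_le1 ?ltr0n ?ler1n ?fact_gt0.
apply: le_trans (ler_norm_sum _ _ _) _.
apply: le_trans (_ : \sum_(s : 'S_7) A <= _); last first.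
  by rewrite sumr_const card_Sn mulr_natl.
apply: ler_sum => s _; rewrite !normrM normrX normrN1 expr1n mul1r.
rewrite -[leRHS]mulr1 ler_pM // normr_prod.
(* On frame vectors the dual coframe only takes the values 0 and 1. *)
apply: prodr_ile1 => j _; rewrite normr_ge0 /=.
by rewrite rowE -mulmxA mulmxV // mulmx1 mxE normr_nat lern1 leq_b1.
Qed.

(** A single square is at most the whole sum; the factor 1/k! under the root is absorbed by the
    crude constant k!. *)
Lemma le_frame_norm k (a : covec k) E (f : 'I_k -> 'I_7) :
  `|a (fun i => row (f i) E)| <= k`!%:R * frame_norm E a.
Proof.
rewrite -ler_sqr ?nnegrE ?mulr_ge0 ?sqrtr_ge0 ?normr_ge0 ?ler0n //.
rewrite real_normK ?num_real // exprMn sqr_sqrtr; last first.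
  by rewrite mulr_ge0 ?invr_ge0 ?ler0n // sumr_ge0 // => i _; exact: sqr_ge0.
rewrite expr2 -mulrA mulVKf ?pnatr_eq0 -?lt0n ?fact_gt0 //.
have -> : (fun i => row (f i) E) = (fun i => row (finfun f i) E).
  by apply/funext => i; rewrite ffunE.
rewrite (bigD1 (finfun f)) //= mulrDr.
rewrite -[leLHS]addr0 lerD ?mulr_ge0 ?ler0n //.
  by rewrite ler_peMl ?sqr_ge0 // ler1n fact_gt0.
by rewrite sumr_ge0 // => i _; exact: sqr_ge0.
Qed.

End Covectors.
Arguments vecs {R} k s i.

(** * Exterior derivative of the G2-form in a chart *)

Section Calculus.
Context {R : realType} (M : manifold7 R).
Local Notation V := 'rV[R]_7.
Implicit Types (c : chart M) (p q : M).

Lemma wedge_theta_omega (t : covec 1) (w : covec 2) (r m : covec 3) (E : 'M[R]_7)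
    (x y z : V) : SU3_frame t w r m E ->
  ext_wedge t w (vecs 3 [:: x; y; z]) =
  t (vecs 1 [:: x]) * w (vecs 2 [:: y; z])
  - t (vecs 1 [:: y]) * w (vecs 2 [:: x; z])
  + t (vecs 1 [:: z]) * w (vecs 2 [:: x; y]).
Proof.
move=> [uE /(pullbackK uE) -> /(pullbackK uE) -> _ _].
have -> (u : 'I_3 -> V) :
  ext_wedge (pullback (invmx E) theta0) (pullback (invmx E) omega0) u =
  pullback (invmx E) (ext_wedge theta0 omega0) u by [].
by rewrite !pullback_vecs //= wedge_theta0_omega0.
Qed.

Lemma vecs_lift k (s : seq V) (i : 'I_k.+1) : size s = k.+1 ->
  (fun j => vecs k.+1 s (lift i j)) = vecs k (take i s ++ drop i.+1 s).
Proof.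
move=> sk; apply/funext => j; rewrite /vecs /= nth_cat size_take sk ltn_ord.
rewrite /bump; case: ltnP => ij; first by rewrite nth_take.
by rewrite nth_drop addSn subnKC.
Qed.

Lemma near_crd c p (P : 'rV[R]_7 -> Prop) : chart_dom c p ->
  (forall q, chart_dom c q -> P (crd c q)) -> \forall x \near crd c p, P x.
Proof.
move=> cp HP; have : nbhs (crd c p) (crd c @` chart_dom c).
  by apply: open_nbhs_nbhs; split; [exact: img_open|exists p].
by apply: filterS => _ [q cq <-]; exact: HP.
Qed.

Lemma form_differentiable (W : set M) k (a : kform M k) c p v :
  is_form W a -> W p -> chart_dom c p ->
  differentiable (fun x => a c (icrd c x) v) (crd c p).
Proof. by move=> [_ _ sa] Wp cp; apply: (sa c v 1%N).1; exists p. Qed.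

Lemma smooth_fun_differentiable (W : set M) (f : M -> R) c p :
  smooth_fun W f -> W p -> chart_dom c p ->
  differentiable (f \o icrd c) (crd c p).
Proof. by move=> sf Wp cp; apply: (sf c 1%N).1; exists p. Qed.

Section DPhi.
Variables (theta : kform M 1) (omega : kform M 2) (ReU ImU : kform M 3).
Hypothesis M_CY : contact_calabi_yau theta omega ReU ImU.
Variable h : M -> R.
Hypothesis h_smooth : smooth_fun [set p | 0 < h p] h.
Variables (c : chart M) (p : M).
Hypotheses (cp : chart_dom c p) (hp : 0 < h p).

Let D k (a : kform M k) (v : V) w : R := 'D_v (fun x => a c (icrd c x) w) (crd c p).

Lemma derive_ccy_phi (v x y z : V)
    (T := fun x => theta c p (vecs 1 [:: x]))
    (W := fun x y => omega c p (vecs 2 [:: x; y]))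
    (DT := fun v x => D theta v (vecs 1 [:: x]))
    (DW := fun v x y => D omega v (vecs 2 [:: x; y])) :
  D (ccy_phi h theta omega ReU) v (vecs 3 [:: x; y; z]) =
  'D_v (h \o icrd c) (crd c p) * (T x * W y z - T y * W x z + T z * W x y)
  + h p * (DT v x * W y z + T x * DW v y z - DT v y * W x z - T y * DW v x z
           + DT v z * W x y + T z * DW v x y)
  + D ReU v (vecs 3 [:: x; y; z]).
Proof.
pose th x (s : V) := theta c (icrd c s) (vecs 1 [:: x]).
pose om x y (s : V) := omega c (icrd c s) (vecs 2 [:: x; y]).
pose re (s : V) := ReU c (icrd c s) (vecs 3 [:: x; y; z]).
(* A frame at each nearby point expands the wedge into products of functions, to which the Leibniz
   rule applies. *)
rewrite /D (@near_eq_derive _ _ _ _ ((h \o icrd c) *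
  (th x * om y z - th y * om x z + th z * om x y) + re)); last first.
  apply: near_crd cp _ => q cq; rewrite /ccy_phi crdK //.
  have [E SE] := ccy_SU3 M_CY cq.
  by rewrite (wedge_theta_omega _ _ _ SE) /= !fctE /= /th /om /re crdK.
have dh : is_derive (crd c p) v (h \o icrd c) ('D_v (h \o icrd c) (crd c p)).
  exact/derivableP/diff_derivable/(smooth_fun_differentiable h_smooth).
have dth u : is_derive (crd c p) v (th u) (DT v u).
  exact/derivableP/diff_derivable/(form_differentiable _ (ccy_theta_form M_CY)).
have dom u w : is_derive (crd c p) v (om u w) (DW v u w).
  exact/derivableP/diff_derivable/(form_differentiable _ (ccy_omega_form M_CY)).
have dre : is_derive (crd c p) v re (D ReU v (vecs 3 [:: x; y; z])).
  exact/derivableP/diff_derivable/(form_differentiable _ (ccy_ReU_form M_CY)).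
rewrite derive_val !fctE /GRing.scale /= /th /om crdK //.
by rewrite -/(D ReU v _) /T /W; ring.
Qed.

(** The terms in [H] are those of dh /\ theta /\ omega; the last line is h omega /\ omega, coming
    from d theta = omega. The contributions of d omega and d ReU vanish. *)
Lemma ext_d_ccy_phi (v0 v1 v2 v3 : V)
    (T := fun x => theta c p (vecs 1 [:: x]))
    (W := fun x y => omega c p (vecs 2 [:: x; y]))
    (H := fun v => 'D_v (h \o icrd c) (crd c p)) :
  ext_d (ccy_phi h theta omega ReU) c p (vecs 4 [:: v0; v1; v2; v3]) =
  H v0 * (T v1 * W v2 v3 - T v2 * W v1 v3 + T v3 * W v1 v2)
  - H v1 * (T v0 * W v2 v3 - T v2 * W v0 v3 + T v3 * W v0 v2)
  + H v2 * (T v0 * W v1 v3 - T v1 * W v0 v3 + T v3 * W v0 v1)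
  - H v3 * (T v0 * W v1 v2 - T v1 * W v0 v2 + T v2 * W v0 v1)
  + 2 * h p * (W v0 v1 * W v2 v3 - W v0 v2 * W v1 v3 + W v0 v3 * W v1 v2).
Proof.
have E2 (a : kform M 1) x y : ext_d a c p (vecs 2 [:: x; y]) =
    D a x (vecs 1 [:: y]) - D a y (vecs 1 [:: x]).
  rewrite /ext_d !big_ord_recl big_ord0 /= /D !vecs_lift // /bump /=; ring.
have E3 (a : kform M 2) x y z : ext_d a c p (vecs 3 [:: x; y; z]) =
    D a x (vecs 2 [:: y; z]) - D a y (vecs 2 [:: x; z]) + D a z (vecs 2 [:: x; y]).
  rewrite /ext_d !big_ord_recl big_ord0 /= /D !vecs_lift // /bump /=; ring.
have E4 (a : kform M 3) x y z t : ext_d a c p (vecs 4 [:: x; y; z; t]) =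
    D a x (vecs 3 [:: y; z; t]) - D a y (vecs 3 [:: x; z; t])
    + D a z (vecs 3 [:: x; y; t]) - D a t (vecs 3 [:: x; y; z]).
  rewrite /ext_d !big_ord_recl big_ord0 /= /D !vecs_lift // /bump /=; ring.
have dT x y := ccy_dtheta M_CY cp (vecs 2 [:: x; y]).
have dW x y z := ccy_domega M_CY cp (vecs 3 [:: x; y; z]).
have := ccy_dReU M_CY cp (vecs 4 [:: v0; v1; v2; v3]).
rewrite !E4 !derive_ccy_phi.
move: (dT v0 v1) (dT v0 v2) (dT v0 v3) (dT v1 v2) (dT v1 v3) (dT v2 v3).
move: (dW v0 v1 v2) (dW v0 v1 v3) (dW v0 v2 v3) (dW v1 v2 v3).
rewrite !E2 !E3 -!/(H _) /T /W {dT dW E2 E3 E4}.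
move: (D omega) (D theta) (D ReU) (omega c p) (theta c p) (h p) => dw dt dr w t hp'.
move: H => {T W} H.
(* Each structure equation is solved for its first derivative: four from d omega = 0, six from d
   theta = omega, then one from d ReU = 0. *)
do 4![move/(canRL (addrK _))/(canRL (subrK _)) => ->].
do 6![move/(canRL (subrK _)) => ->].
move/(canRL (subrK _))/(canRL (addrK _))/(canRL (subrK _)) => ->.
by ring.
Qed.

End DPhi.
End Calculus.

(** * From bounded torsion to a bound on the horizontal derivatives of log h *)

Section TorsionBound.
Context {R : realType} (M : manifold7 R).
Local Notation V := 'rV[R]_7.

(** On its own frames every G2-form takes the values of [phi0] on the standard basis, so one bound
    serves all points. *)
Lemma G2_frame_bound : exists B : R, forall (f : covec 3) (E : 'M[R]_7),
  G2_frame f E -> forall w : 'I_3 -> 'I_7, `|f (fun i => row (w i) E)| <= B.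
Proof.
pose F (w : {ffun 'I_3 -> 'I_7}) : R := `|phi0 (fun i => delta_mx ord0 (w i))|.
exists (\sum_w F w) => f E [_ fE] w.
have -> : f (fun i => row (w i) E) = phi0 (fun i => delta_mx ord0 (w i)).
  by rewrite -fE /pullback; congr f; apply/funext => i; rewrite rowE.
have -> : (fun i => delta_mx ord0 (w i)) =
          (fun i => delta_mx ord0 (finfun w i)) :> ('I_3 -> V).
  by apply/funext => i; rewrite ffunE.
rewrite (bigD1 (finfun w)) /= ?lerDl; last by [].
by apply: sumr_ge0 => i _; exact: normr_ge0.
Qed.

Variables (theta : kform M 1) (omega : kform M 2) (ReU ImU : kform M 3) (h : M -> R).
Hypothesis M_CY : contact_calabi_yau theta omega ReU ImU.
Hypothesis h_smooth : smooth_fun [set p | 0 < h p] h.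
Variables (t1 : M -> R) (t7 : kform M 1) (t14 : kform M 2) (t27 : kform M 3).
Let phi := ccy_phi h theta omega ReU.
Let psi := ccy_starphi h theta omega ImU.
Hypothesis torsion : G2_torsion [set p | 0 < h p] phi psi t1 t7 t14 t27.
Hypothesis tor_bounded : bounded_torsion [set p | 0 < h p] phi t1 t7 t14 t27.

Lemma ext_d_phi_bound : exists K : R, forall c p E,
  0 < h p -> chart_dom c p -> G2_frame (phi c p) E ->
  forall w : 'I_4 -> 'I_7, `|ext_d phi c p (fun i => row (w i) E)| <= K.
Proof.
have [C tC] := tor_bounded; have [B fB] := G2_frame_bound.
(* The summands bound, in this order, [t1 psi], [3 t7 /\ phi] and the Hodge star of [t27]. *)
exists (C * (7`!%:R * B) + 3 * (4`!%:R * (1`!%:R * C * B)) + 7`!%:R * (3`!%:R * C)).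
move=> c p E hp cp GE w.
have [tC1 tC7 _ tC27] := tC c p E hp cp GE; have uE := GE.1.
rewrite (tor_dphi torsion hp cp GE).
rewrite (le_trans (ler_normD _ _)) // lerD //; last first.
  apply: (@hodge_le _ 3 (t27 c p) E w) => // f.
  by apply: le_trans (le_frame_norm _ _ _) _; rewrite ler_pM2l ?ltr0n.
rewrite (le_trans (ler_normD _ _)) // lerD //.
  rewrite normrM ler_pM // (tor_psi torsion hp cp GE).
  by apply: (@hodge_le _ 3 (phi c p) E w) => // f; exact: fB.
rewrite normrM ger0_norm // ler_pM2l ?ltr0n //.
apply: (@ext_wedge_le _ 1 3) => f; last exact: fB.
by apply: le_trans (le_frame_norm _ _ _) _; rewrite ler_pM2l ?ltr0n.
Qed.

Lemma derive_row_bound : exists K : R, forall c p E i,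
  0 < h p -> chart_dom c p ->
  SU3_frame (theta c p) (omega c p) (ReU c p) (ImU c p) E ->
  (0 < i < 7)%N -> `|'D_(std i *m E) (h \o icrd c) (crd c p)| <= K * h p.
Proof.
have [K dK] := ext_d_phi_bound; exists K => c p E i hp cp SE i7.
pose H (v : V) : R := 'D_v (h \o icrd c) (crd c p); rewrite -/(H _).
have GE := SU3_frame_G2 hp SE; have [uE tE wE _ _] := SE.
(* The four vectors belong to the G2-frame obtained from [E] by dividing its Reeb vector by
   [h p]. *)
have {}dK j k : (j < 6)%N -> (k < 6)%N -> `|ext_d phi c p (vecs 4
    [:: std i *m E; (h p)^-1 *: (std 0 *m E); std j.+1 *m E; std k.+1 *m E])| <= K.
  move=> j6 k6; set v := vecs 4 _.
  have -> : v = fun a => row (nth ord0 [:: inord i; ord0; inord j.+1; inord k.+1] a)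
                             (diag_head (h p)^-1 *m E).
    have nz m : (0 < m < 7)%N -> inord m != ord0 :> 'I_7.
      by case/andP=> m0 m7; rewrite -val_eqE /= inordK // -lt0n.
    have r0 : std 0 *m E = row ord0 E.
      by rewrite std_mul; congr row; apply/val_inj; rewrite /= inordK.
    rewrite /v; apply/funext; case=> [[|[|[|[|//]]]] ?]; rewrite /vecs /=.
    - by rewrite rowS_diag_head ?std_mul ?nz.
    - by rewrite row0_diag_head r0.
    - by rewrite rowS_diag_head ?std_mul ?nz.
    - by rewrite rowS_diag_head ?std_mul ?nz.
  exact: dK.
have tS x : theta c p (vecs 1 [:: x *m E]) = theta0 (vecs 1 [:: x]).
  by rewrite -tE pullback_vecs.
have wS x y : omega c p (vecs 2 [:: x *m E; y *m E]) = omega0 (vecs 2 [:: x; y]).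
  by rewrite -wE pullback_vecs.
(* As omega kills the Reeb vector, h omega /\ omega vanishes on this tuple; the three conditions on
   [omega0] leave [H (std i *m E) / h p]. *)
have {}dK j k : (j < 6)%N -> (k < 6)%N ->
   omega0 (vecs 2 [:: std i : V; std j.+1]) = 0 ->
   omega0 (vecs 2 [:: std i : V; std k.+1]) = 0 ->
   omega0 (vecs 2 [:: std j.+1 : V; std k.+1]) = 1 ->
   `|H (std i *m E)| <= K * h p.
  move=> j6 k6 ij ik jk; have := dK j k j6 k6.
  have sc (a : R) (x : V) k' : (a *: x)`_[k'] = a * x`_[k'] by rewrite mxE.
  have w0 x : omega c p (vecs 2 [:: (h p)^-1 *: (std 0 *m E); x *m E]) = 0.
    by rewrite scalemxAl wS omega0E !sc !stdE //=; ring.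
  have w0' x : omega c p (vecs 2 [:: x *m E; (h p)^-1 *: (std 0 *m E)]) = 0.
    by rewrite scalemxAl wS omega0E !sc !stdE //=; ring.
  rewrite (ext_d_ccy_phi M_CY h_smooth cp hp) !w0 !w0' !wS ij ik jk.
  rewrite scalemxAl !tS !theta0E sc !stdE //; last by case/andP: i7.
  have /negPf -> : i != 0%N by rewrite -lt0n; case/andP: i7.
  rewrite /= !(mulr0, mul0r, mulr1, addr0, subr0, sub0r, oppr0) -/(H _) normrM.
  by rewrite normfV (gtr0_norm hp) ler_pdivrMr.
move: i7 => /andP[]; move: i dK.
(* The pair is a basis of a complex line other than that of [std i], the next one cyclically; its
   indices are given shifted down by one. *)
move=> [|[|[|[|[|[|[|//]]]]]]] // dK _ _;
  [apply: (dK 2%N 3%N)|apply: (dK 2%N 3%N)|apply: (dK 4%N 5%N)|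
   apply: (dK 4%N 5%N)|apply: (dK 0%N 1%N)|apply: (dK 0%N 1%N)] => //;
  by rewrite omega0E !stdE //=; ring.
Qed.

End TorsionBound.

(** * Finite bounds and expansion of covectors in a frame *)

Section LocalFrameBound.
Context {R : realType}.
Local Notation V := 'rV[R]_7.

Lemma fin_bound (I : finType) (F : I -> R) : exists2 B, 0 <= B & forall i, F i <= B.
Proof.
exists (\sum_i `|F i|); first by apply: sumr_ge0 => i _; exact: normr_ge0.
move=> i; rewrite (bigD1 i) //= (le_trans (ler_norm _)) // lerDl.
by apply: sumr_ge0 => j _; exact: normr_ge0.
Qed.

Lemma norm_sum_le (I : finType) (b a : I -> R) (e : R) : (forall i, `|a i| <= e) ->
  `|\sum_i b i * a i| <= (\sum_i `|b i|) * e.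
Proof.
move=> ae; rewrite mulr_suml (le_trans (ler_norm_sum _ _ _)) // ler_sum // => i _.
by rewrite normrM ler_wpM2l.
Qed.

Lemma covec_linear k (a : covec k) (s : seq V) (i : 'I_k) t x y :
  alternating_covec a ->
  a (vecs k (set_nth 0 s i (t *: x + y))) =
  t * a (vecs k (set_nth 0 s i x)) + a (vecs k (set_nth 0 s i y)).
Proof.
move=> [lin _]; have E z : vecs k (set_nth 0 s i z) = [eta vecs k s with i |-> z].
  by apply/funext => j; rewrite /vecs nth_set_nth.
by rewrite !E lin.
Qed.

(** Multilinearity in slot [i]; the entry of [s] there is overwritten, so it may be any
    placeholder. *)
Lemma covec_row_sum k (a : covec k) (s : seq V) (i : 'I_k) (b : V) (E : 'M[R]_7) :
  alternating_covec a ->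
  a (vecs k (set_nth 0 s i (b *m E))) =
  \sum_(l < 7) b ord0 l * a (vecs k (set_nth 0 s i (std l *m E))).
Proof.
move=> alta; have a0 : a (vecs k (set_nth 0 s i 0)) = 0.
  by have := covec_linear s i (-1) 0 0 alta; rewrite scaler0 addr0 mulN1r addNr.
rewrite mulmx_sum_row; elim/big_rec2: _ => // l x y _ IH.
by rewrite covec_linear // IH std_mul inord_val.
Qed.

Lemma std_inord i : std (inord i : 'I_7) = std i :> V.
Proof. by rewrite /std inord_val. Qed.

End LocalFrameBound.

(** * Local bound on horizontal coordinates, uniform in the SU(3)-frames *)

Section LocalBound.
Context {R : realType} (M : manifold7 R).
Local Notation V := 'rV[R]_7.
Variables (theta : kform M 1) (omega : kform M 2) (ReU ImU : kform M 3).
Hypothesis M_CY : contact_calabi_yau theta omega ReU ImU.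

Lemma form_near k (a : kform M k) c p v (e : R) : is_form setT a -> chart_dom c p ->
  0 < e -> \forall x \near crd c p, `|a c (icrd c x) v - a c p v| <= e.
Proof.
move=> fa cp e0.
have /cvgrPdist_le/(_ e e0) :=
  differentiable_continuous (form_differentiable v fa (I : setT p) cp).
by apply: filterS => x /=; rewrite crdK // distrC.
Qed.

(* With J the complex structure, [ReU (J v, ., .) = - ImU (v, ., .)] bounds [J v],
   since the values [ReU (., f_j, f_k)] on the frame [f] at [p] are coordinates up
   to sign at [p] and vary continuously. The sum of the squares of the horizontal
   coordinates of [v] is then [omega (v, J v)]. *)
Lemma near_coord_bound c p (v : V) : chart_dom c p -> exists2 B : R, 0 <= B &
  \forall x \near crd c p, forall E,
    SU3_frame (theta c (icrd c x)) (omega c (icrd c x)) (ReU c (icrd c x))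
      (ImU c (icrd c x)) E ->
    forall i, (0 < i < 7)%N -> `|(v *m invmx E)`_[i]| <= B.
Proof.
move=> cp; have [F [uF tF _ rF _]] := ccy_SU3 M_CY cp.
pose f (l : 'I_7) : V := std l *m F.
have [B1 B1_ge0 HB1] := fin_bound (fun l => `|omega c p (vecs 2 [:: v; f l])|).
have [B2 B2_ge0 HB2] := fin_bound (fun jk : 'I_7 * 'I_7 =>
  `|ImU c p (vecs 3 [:: v; f jk.1; f jk.2])|).
(* With seven coordinates, an error of 1/14 in each value gives [S <= 7 (B2 + 1) + S / 2] below,
   which can be solved for [S]. *)
have e0 : (0 : R) < 14^-1 by rewrite invr_gt0 ltr0n.
have Nt : \forall x \near crd c p, forall l,
    `|theta c (icrd c x) (vecs 1 [:: f l]) - theta c p (vecs 1 [:: f l])| <= 14^-1.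
  apply: (@filter_forall _ _ _ (nbhs (crd c p)) _) => l.
  by apply: form_near => //; exact: ccy_theta_form M_CY.
have Nr : \forall x \near crd c p, forall i : 'I_7 * 'I_7 * 'I_7,
    `|ReU c (icrd c x) (vecs 3 [:: f i.1.1; f i.1.2; f i.2]) -
      ReU c p (vecs 3 [:: f i.1.1; f i.1.2; f i.2])| <= 14^-1.
  apply: (@filter_forall _ _ _ (nbhs (crd c p)) _) => l.
  by apply: form_near => //; exact: ccy_ReU_form M_CY.
have Nw : \forall x \near crd c p, forall l,
    `|omega c (icrd c x) (vecs 2 [:: v; f l]) - omega c p (vecs 2 [:: v; f l])| <= 1.
  apply: (@filter_forall _ _ _ (nbhs (crd c p)) _) => l.
  by apply: form_near => //; exact: ccy_omega_form M_CY.
have Nm : \forall x \near crd c p, forall i : 'I_7 * 'I_7,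
    `|ImU c (icrd c x) (vecs 3 [:: v; f i.1; f i.2]) -
      ImU c p (vecs 3 [:: v; f i.1; f i.2])| <= 1.
  apply: (@filter_forall _ _ _ (nbhs (crd c p)) _) => l.
  by apply: form_near => //; exact: ccy_ImU_form M_CY.
(* The product bounds the square of a coordinate, and |a| <= 1 + a^2. *)
exists (1 + 14 * (B2 + 1) * (B1 + 1)).
  by rewrite addr_ge0 // !mulr_ge0 // addr_ge0.
have Nc : \forall x \near crd c p, chart_dom c (icrd c x).
  by apply: near_crd cp _ => q cq; rewrite crdK.
have FF : Filter (nbhs (crd c p)).
  by apply: filter_filter.
have fI P Q : nbhs (crd c p) P -> nbhs (crd c p) Q -> nbhs (crd c p) (P `&` Q).
  exact: filterI.
have NN := fI _ _ (fI _ _ Nt Nr) (fI _ _ (fI _ _ Nw Nm) Nc).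
apply: (@filterS _ _ FF _ _ _ NN) => x {NN Nt Nr Nw Nm Nc}.
move=> [[Nt Nr] [[Nw Nm] cq]] E SE i i7.
set q := icrd c x in Nt Nr Nw Nm cq SE.
have [uE /(pullbackK uE) tE /(pullbackK uE) wE] := SE.
move=> /(pullbackK uE) rE /(pullbackK uE) mE.
have [tA _ _] := ccy_theta_form M_CY; have [wA _ _] := ccy_omega_form M_CY.
have [rA _ _] := ccy_ReU_form M_CY.
(* [a] holds the coordinates of [v] in the varying frame [E] at [q]; [b] those of [J v], for the
   complex structure at [q], in the fixed frame [F] at [p]. *)
set a := v *m invmx E; pose Jv := cplxJ a *m E; pose b := Jv *m invmx F.
have JvE : Jv = b *m F by rewrite mulmxKV.
pose S := \sum_l `|b ord0 l|.
have S0 : 0 <= S by apply: sumr_ge0 => l _; exact: normr_ge0.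
have bb l : (l < 7)%N -> `|b`_[l]| <= B2 + 1 + S * 14^-1.
  case: l => [_|l l7].
    (* theta at [q] vanishes on [J v], so only the variation of theta between [q] and [p]
       remains. *)
    have -> : b`_[0] = \sum_l b ord0 l *
        (theta c p (vecs 1 [:: f l]) - theta c q (vecs 1 [:: f l])).
      under eq_bigr do rewrite mulrBr.
      rewrite sumrB -!(covec_row_sum [:: 0] ord0) /=; [|exact: tA..].
      rewrite -JvE tE pullback_vecs //= mulmxK // theta0_cplxJ subr0.
      by rewrite JvE -theta0E -tF pullback_vecs.
    apply: le_trans (norm_sum_le (e := 14^-1) _ _) _.
      by move=> l; rewrite distrC; exact: Nt.
    by rewrite lerDr addr_ge0.
  have [j [k ->]] := coord_ReUpsilon0 b (i := l.+1) l7.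
  rewrite -(std_inord j) -(std_inord k); set j' := inord j; set k' := inord k.
  have -> : ReUpsilon0 (vecs 3 [:: b; std j'; std k']) =
      ReU c q (vecs 3 [:: Jv; f j'; f k']) + \sum_l b ord0 l *
        (ReU c p (vecs 3 [:: f l; f j'; f k']) - ReU c q (vecs 3 [:: f l; f j'; f k'])).
    under eq_bigr do rewrite mulrBr.
    rewrite sumrB -!(covec_row_sum [:: 0; f j'; f k'] ord0) /=; [|exact: rA..].
    by rewrite -JvE addrC subrK JvE -rF pullback_vecs.
  apply: le_trans (ler_normD _ _) _; apply: lerD; last first.
    by apply: norm_sum_le => m; rewrite distrC; exact: (Nr (m, j', k')).
  have -> : ReU c q (vecs 3 [:: Jv; f j'; f k']) = - ImU c q (vecs 3 [:: v; f j'; f k']).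
    by rewrite rE mE !pullback_vecs //= mulmxK // ReUpsilon0_cplxJ.
  rewrite normrN -[X in `|X|](subrK (ImU c p (vecs 3 [:: v; f j'; f k']))).
  apply: le_trans (ler_normD _ _) _; rewrite addrC.
  by apply: lerD; [exact: (HB2 (j', k'))|exact: (Nm (j', k'))].
have S_le : S <= 14 * (B2 + 1).
  have : S <= \sum_(l < 7) (B2 + 1 + S * 14^-1).
    by apply: ler_sum => l _; have := bb l (ltn_ord l); rewrite inord_val.
  by rewrite sumr_const card_ord -mulr_natl; lra.
have a2 : (a`_[i]) ^+ 2 <= 14 * (B2 + 1) * (B1 + 1).
  apply: le_trans (_ : omega c q (vecs 2 [:: v; Jv]) <= _).
    rewrite wE pullback_vecs //= mulmxK // omega0_cplxJ.
    have s2 k := sqr_ge0 (a`_[k]).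
    have := (s2 1%N, s2 2%N, s2 3%N, s2 4%N, s2 5%N, s2 6%N).
    move: i7 => /andP[]; move: i => [|[|[|[|[|[|[|//]]]]]]] // _ _ [[[[[]]]]]; lra.
  (* In the fixed frame the values [omega (v, f l)] at [q] are at most [B1 + 1], and [S] bounds the
     sum of the |b_l|. *)
  rewrite JvE (covec_row_sum [:: v; 0] (lift ord0 ord0)) /=; last exact: wA.
  apply: le_trans (ler_norm _) _; apply: le_trans (norm_sum_le (e := B1 + 1) _ _) _.
    move=> l; rewrite -[X in `|X|](subrK (omega c p (vecs 2 [:: v; f l]))).
    apply: le_trans (ler_normD _ _) _; rewrite addrC.
    by apply: lerD; [exact: HB1|exact: Nw].
  by rewrite ler_wpM2r // addr_ge0.
have : `|a`_[i]| <= 1 + (a`_[i]) ^+ 2.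
  by rewrite -real_normK ?num_real //; have := sqr_ge0 (`|a`_[i]| - 1); nra.
by move/le_trans; apply; rewrite lerD2l.
Qed.

End LocalBound.

(** * The differential inequality |dh| <= L h near any point of a chart *)

Section DifferentialInequality.
Context {R : realType} (M : manifold7 R).
Local Notation V := 'rV[R]_7.
Variables (theta : kform M 1) (omega : kform M 2) (ReU ImU : kform M 3).
Variables (xi : vfield M) (Phi : flow M) (h : M -> R).
Hypothesis M_CY : contact_calabi_yau theta omega ReU ImU.
Hypothesis xi_reeb : reeb theta omega ReU ImU xi.
Hypothesis Phi_flow : flow_of xi Phi.
Hypothesis h_invariant : forall t p, h (Phi t p) = h p.
Hypothesis h_smooth : smooth_fun [set p | 0 < h p] h.

(** Chain rule at time 0 along the integral curve through [p], on which [h] is constant. *)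
Lemma derive_reeb c p : 0 < h p -> chart_dom c p ->
  'D_(xi c p) (h \o icrd c) (crd c p) = 0.
Proof.
move=> hp cp; pose g t := Phi t p.
have [g_cont g_der] : integral_curve xi g := Phi_flow p.
have g0 : g 0 = p by rewrite /g flow0.
have dg : is_derive (0 : R) (1 : R) (crd c \o g) (xi c p).
  by rewrite -g0; apply: (g_der 0 c); rewrite g0.
have dgd : differentiable (crd c \o g) (0 : R) by apply/derivable1_diffP.
have dhd : differentiable (h \o icrd c) ((crd c \o g) 0).
  by rewrite /= g0; exact: smooth_fun_differentiable h_smooth hp cp.
have := diff_comp dgd dhd => /(congr1 (fun f => f 1)) /=.
rewrite -!deriveE //; last exact: differentiable_comp.
rewrite [in RHS](_ : 'D_1 (crd c \o g) 0 = xi c p) /=; last exact: derive_val.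
rewrite g0 => <-.
rewrite (@near_eq_derive _ _ _ _ (cst (h p))) ?derive_cst //.
have : \forall t \near (0 : R), chart_dom c (g t).
  have /(_ (chart_dom c)) := g_cont 0; apply; rewrite g0.
  by apply: open_nbhs_nbhs; split => //; exact: dom_open.
by apply: filterS => t /= ct; rewrite crdK // /g h_invariant.
Qed.

Lemma reeb_frame c p E : chart_dom c p ->
  SU3_frame (theta c p) (omega c p) (ReU c p) (ImU c p) E ->
  xi c p = std 0 *m E.
Proof.
move=> cp SE; rewrite std_mul.
have -> : inord 0 = ord0 :> 'I_7 by apply/val_inj; rewrite /= inordK.
apply: (reeb_row SE).
  by rewrite -(reeb_theta xi_reeb cp); congr (theta c p); rewrite [RHS]vecs1.
move=> y; have [+ _] := reeb_omega xi_reeb cp => /(_ (fun=> y)) <-.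
rewrite /contract; congr (omega c p); rewrite [RHS]vecs2.
by rewrite unlift_none liftK.
Qed.

Variables (t1 : M -> R) (t7 : kform M 1) (t14 : kform M 2) (t27 : kform M 3).
Let phi := ccy_phi h theta omega ReU.
Let psi := ccy_starphi h theta omega ImU.
Hypothesis torsion : G2_torsion [set p | 0 < h p] phi psi t1 t7 t14 t27.
Hypothesis tor_bounded : bounded_torsion [set p | 0 < h p] phi t1 t7 t14 t27.

(** Expansion of [v] in an SU(3)-frame: the Reeb term vanishes, and in the others the coordinate is
    at most [B] and the derivative at most [K h]. The constants survive up to zeros of [h]: [p]
    itself may be one. *)
Lemma near_derive_bound_dir c p (v : V) : chart_dom c p -> exists2 L, 0 <= L &
  \forall x \near crd c p, 0 < h (icrd c x) ->
    `|'D_v (h \o icrd c) x| <= L * h (icrd c x).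
Proof.
move=> cp; have [K dK] := derive_row_bound M_CY h_smooth torsion tor_bounded.
have [B B0 nB] := near_coord_bound M_CY v cp.
exists (\sum_(l < 7) B * `|K|).
  by apply: sumr_ge0 => l _; rewrite mulr_ge0.
have FF : Filter (nbhs (crd c p)) by apply: filter_filter.
have Nc : nbhs (crd c p) (crd c @` chart_dom c).
  by apply: near_crd cp _ => q cq; exists q.
apply: (@filterS _ _ FF _ _ _ (@filterI _ _ FF _ _ nB Nc)).
move=> x [+ [q cq qx]] hq; rewrite -{x}qx crdK // in hq * => {}nB.
have [E SE] := ccy_SU3 M_CY cq; have uE : E \in unitmx by case: SE.
have dh := smooth_fun_differentiable h_smooth hq cq.
set a := v *m invmx E.
have -> : v = \sum_l a ord0 l *: (std l *m E).
  rewrite -[LHS](mulmxKV uE) mulmx_sum_row; apply: eq_bigr => l _.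
  by rewrite std_mul inord_val.
rewrite deriveE // linear_sum mulr_suml.
apply: le_trans (ler_norm_sum _ _ _) _; apply: ler_sum => l _.
rewrite linearZ -deriveE // normrM.
have [l0|l0] := eqVneq (l : nat) 0%N.
  by rewrite l0 -(reeb_frame cq SE) derive_reeb // normr0 mulr0 !mulr_ge0 // ltW.
rewrite -mulrA; apply: ler_pM => //.
  have := nB E SE l; rewrite inord_val; apply.
  by rewrite lt0n l0 ltn_ord.
apply: le_trans (dK c q E l hq cq SE _) _; first by rewrite lt0n l0 ltn_ord.
by rewrite ler_wpM2r ?ler_norm // ltW.
Qed.

(** Seven coordinate directions give a bound uniform in [v], whose norm is the maximum of the
    |v_l|. *)
Lemma near_derive_bound c p : chart_dom c p -> exists2 L, 0 <= L &
  \forall x \near crd c p, 0 < h (icrd c x) ->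
    forall v : V, `|'D_v (h \o icrd c) x| <= L * `|v| * h (icrd c x).
Proof.
move=> cp.
have /choice[L HL] (l : 'I_7) : exists L, 0 <= L /\
  \forall x \near crd c p, 0 < h (icrd c x) ->
    `|'D_(std l) (h \o icrd c) x| <= L * h (icrd c x).
  by have [L] := near_derive_bound_dir (std l) cp; exists L.
exists (\sum_l L l); first by apply: sumr_ge0 => l _; case: (HL l).
have FF : Filter (nbhs (crd c p)) by apply: filter_filter.
have NL : \forall x \near crd c p, forall l : 'I_7, 0 < h (icrd c x) ->
    `|'D_(std l) (h \o icrd c) x| <= L l * h (icrd c x).
  by apply: (@filter_forall _ _ _ _ FF) => l; case: (HL l).
have Nc : nbhs (crd c p) (crd c @` chart_dom c).
  by apply: near_crd cp _ => q cq; exists q.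
apply: (@filterS _ _ FF _ _ _ (@filterI _ _ FF _ _ NL Nc)).
move=> x [{}NL [q cq qx]] hq v; have {}NL l := NL l hq.
rewrite -{x}qx crdK // in hq NL *.
have dh := smooth_fun_differentiable h_smooth hq cq.
have -> : 'D_v (h \o icrd c) (crd c q) =
          \sum_l v ord0 l * 'D_(std l) (h \o icrd c) (crd c q).
  rewrite deriveE // {1}(row_sum_delta v) linear_sum.
  by apply: eq_bigr => l _; rewrite linearZ deriveE // /std inord_val.
rewrite -mulrA mulr_suml; apply: le_trans (ler_norm_sum _ _ _) _.
apply: ler_sum => l _; rewrite normrM mulrCA ler_pM //.
rewrite [leRHS](_ : _ = mx_norm v) // mx_normrE.
exact: (le_bigmax _ (fun ij => `|v ij.1 ij.2|) (ord0, l)).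
Qed.

End DifferentialInequality.

(** * One-variable analysis: a Gronwall argument and isolated level points *)

Section RealAnalysis.
Context {R : realType}.

(* The quantity [g s * expR (- L s)] is nonincreasing after the last zero of [g]. *)
Lemma gronwall_zero (g : R -> R) (L : R) :
  (forall s, 0 <= s <= 1 -> {for s, continuous g}) ->
  (forall s, 0 <= s <= 1 -> 0 < g s -> derivable g s 1 /\ 'D_1 g s <= L * g s) ->
  g 0 <= 0 -> g 1 <= 0.
Proof.
move=> gc gd g0; rewrite leNgt; apply/negP => g1.
(* The supremum [m] of [A] is the last point where [g <= 0]; it belongs to [A] by continuity of
   [g]. *)
pose A := [set s : R | 0 <= s <= 1 /\ g s <= 0].
have A0 : A 0 by split => //; rewrite lexx ler01.
have Aub : ubound A 1 by move=> s [/andP[]].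
have supA : has_sup A by split; [exists 0|exists 1].
set m := sup A.
have m0 : 0 <= m by apply: sup_upper_bound.
have m1 : m <= 1 by apply: ge_sup => //; exists 0.
have gm : g m <= 0.
  rewrite leNgt; apply/negP => gm.
  have gcm : {for m, continuous g} by apply: gc; rewrite m0.
  have : \forall s \near m, 0 < g s by exact: (cvgr_gt (g m) gcm).
  move=> /nbhs_ballP[e /= e0 me]; have [s As ms] := sup_adherent e0 supA.
  have sm : s <= m by apply: sup_upper_bound.
  have : 0 < g s.
    by apply: me; rewrite /ball /= ger0_norm ?subr_ge0 // ltrBlDl -ltrBlDr.
  by rewrite ltNge As.2.
have {}m1 : m < 1.
  by rewrite lt_neqAle m1 andbT; apply: contraTneq g1 => <-; rewrite -leNgt.
have gpos s : m < s -> s <= 1 -> 0 < g s.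
  move=> ms s1; rewrite ltNge; apply: contraTN (ms) => gs; rewrite -leNgt.
  by apply: sup_upper_bound => //; split => //; rewrite s1 (le_trans m0) ?(ltW ms).
pose e s := expR (- (L * s)).
have de (s : R) : is_derive s (1 : R) e (- L * e s).
  have dl : is_derive s (1 : R) (fun s : R => - (L * s)) (- L).
    have dl := is_deriveN (is_deriveZ L (is_derive_id s (1 : R))).
    by apply: (is_derive_eq dl); rewrite /GRing.scale /= mulr1.
  have dexp := @is_derive1_comp _ expR (fun s => - (L * s)) _ _ _ (is_derive_expR _) dl.
  by apply: (is_derive_eq dexp); rewrite mulrC.
have u_der s : m < s -> s <= 1 ->
    is_derive s (1 : R) (g * e) ('D_1 g s * e s - L * g s * e s).
  move=> ms s1; have s01 : 0 <= s <= 1 by rewrite s1 (le_trans m0 (ltW ms)).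
  have [/derivableP dg _] := gd s s01 (gpos s ms s1).
  by apply: (is_derive_eq (is_deriveM dg (de s))); rewrite /GRing.scale /=; ring.
(* At [m] itself [g] need not be derivable; the mean value theorem only asks for continuity
   there. *)
have uc : {within `[m, 1], continuous (g * e)}.
  apply: continuous_in_subspaceT => s; rewrite inE /= in_itv /= => /andP[ms s1].
  apply: cvgM; first by apply: gc; rewrite s1 (le_trans m0 ms).
  by apply/differentiable_continuous/derivable1_diffP; case: (de s).
have der s : s \in `]m, 1[ ->
    is_derive s (1 : R) (g * e) ('D_1 g s * e s - L * g s * e s).
  by rewrite in_itv /= => /andP[ms /ltW]; exact: u_der.
have [s /[!in_itv]/= /andP[ms /ltW s1] gs] := MVT m1 der uc.
have s01 : 0 <= s <= 1 by rewrite s1 (le_trans m0 (ltW ms)).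
have [_ dgs] := gd s s01 (gpos s ms s1).
have : (g * e) 1 <= (g * e) m.
  rewrite -subr_le0 gs mulr_le0_ge0 // ?subr_ge0 ?(ltW m1) //.
  by rewrite -mulrBl mulr_le0_ge0 ?subr_le0 // expR_ge0.
apply/negP; rewrite -ltNge (@le_lt_trans _ _ 0) //.
  by rewrite mulr_le0_ge0 // expR_ge0.
by rewrite mulr_gt0 // expR_gt0.
Qed.

(** A second point of the level would give difference quotient 0, at distance |f'(a)| from its
    limit. The radius 1/(n+1) is coded by an integer for counting purposes. *)
Lemma derivable_level_isolated (f : R -> R) (a : R) :
  derivable f a 1 -> 'D_1 f a != 0 ->
  exists n : nat, forall t, `|t - a| < n.+1%:R^-1 -> f t = f a -> t = a.
Proof.
move=> fa Dfa.
have fD : (fun k => k^-1 *: ((f \o shift a) (k *: (1 : R)) - f a)) @ 0^' --> 'D_1 f a.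
  exact: fa.
move: fD => /cvgrPdist_lt/(_ `|'D_1 f a|); rewrite normr_gt0 => /(_ Dfa).
move=> /nbhs_ballP[e /= e0 He].
have [n ne] : exists n : nat, n.+1%:R^-1 < e.
  exists (Num.truncn e^-1); rewrite invf_plt ?posrE //.
  by apply: truncnS_gt; rewrite invr_ge0 ltW.
exists n => t /lt_trans/(_ ne) ta ft; apply/eqP; apply: contraT => t_neq_a.
have := He (t - a); rewrite /ball /= sub0r normrN subr_eq0 => /(_ ta t_neq_a).
by rewrite /GRing.scale /= mulr1 subrK ft subrr mulr0 subr0 ltxx.
Qed.

Lemma itv_uncountable (e : R) : 0 < e -> ~ countable `]0, e[%classic.
Proof.
move=> e0 /countable_lebesgue_measure0; rewrite lebesgue_measure_itv /= lte_fin e0.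
by rewrite oppr0 addr0 => -[] /eqP; rewrite gt_eqF.
Qed.
End RealAnalysis.

(** * Orbits have empty interior; restriction to lines in a chart *)

Section Orbits.
Context {R : realType} (M : manifold7 R).
Local Notation V := 'rV[R]_7.

Lemma icrd_continuous_at c (q : M) (y w : V) (s : R) : chart_dom c q ->
  y + s *: w = crd c q -> {for s, continuous (fun s : R => icrd c (y + s *: w))}.
Proof.
move=> cq e; apply: continuous_comp.
  by apply: cvgD; [exact: cvg_cst|apply: cvgZr_tmp; exact: cvg_id].
by rewrite e; exact: icrd_continuous.
Qed.

(* Were the orbit to cover a neighbourhood, it would contain a segment transverse
   to the vector field; it meets this segment at isolated, hence countably many,
   times. *)
Lemma orbit_no_interior (X : vfield M) (Phi : flow M) c (p : M) :
  is_vfield X -> flow_of X Phi -> chart_dom c p -> X c p != 0 ->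
  ~ (\forall y \near crd c p, exists t, Phi t p = icrd c y).
Proof.
move=> [_ X_smooth] Phi_flow cp Xp Ny.
have [i Xpi] : exists i, X c p ord0 i != 0.
  apply: contrapT => Hn; move/eqP: Xp; apply; apply/rowP => i; rewrite mxE.
  by apply/eqP; apply: contrapT => /negP ?; apply: Hn; exists i.
(* Along direction [j] coordinate [i] is constant, whereas the field has nonzero coordinate [i]: the
   segment is transverse to it. *)
have [j ji] : exists j : 'I_7, j != i.
  by exists (lift i ord0); rewrite eq_sym neq_lift.
pose w : V := delta_mx ord0 j; pose seg (s : R) := crd c p + s *: w.
pose good y := (exists2 q, chart_dom c q & crd c q = y) /\
  (exists t, Phi t p = icrd c y) /\ X c (icrd c y) ord0 i != 0.
have FF : Filter (nbhs (crd c p)) by apply: filter_filter.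
have Ngood : \forall y \near crd c p, good y.
  have Nc : nbhs (crd c p) (crd c @` chart_dom c).
    by apply: near_crd cp _ => q cq; exists q.
  apply: (@filterI _ _ FF _ _ Nc); apply: (@filterI _ _ FF _ _ Ny).
  have Xc : {for crd c p, continuous (fun y => X c (icrd c y))}.
    by apply: (X_smooth c 0%N); exists p.
  have Xic : {for crd c p, continuous (fun y => X c (icrd c y) ord0 i)}.
    apply: (@continuous_comp _ _ _ (fun y => X c (icrd c y))
      (fun u : V => u ord0 i)) => //.
    exact: coord_continuous.
  by apply: (cvgr_neq0 _ Xic); rewrite crdK.
have [e e0 He] : exists2 e, 0 < e & forall s, `|s| < e -> good (seg s).
  have sc : {for 0, continuous seg}.
    by apply: cvgD; [exact: cvg_cst|apply: cvgZr_tmp; exact: cvg_id].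
  have : \forall s \near (0 : R), good (seg s) by apply: sc; rewrite /seg scale0r addr0.
  move=> /nbhs_ballP[e /= e0 He]; exists e => // s se; apply: He.
  by rewrite /ball /= sub0r normrN.
(* [T s] is a time at which the orbit passes through the point [s] of the segment; [0] is a dummy
   outside the range. *)
have /choice[T HT] s : exists t, `|s| < e -> Phi t p = icrd c (seg s).
  have [se|se] := boolP (`|s| < e); last by exists 0.
  by have [_ [[t tE] _]] := He s se; exists t.
pose f t := crd c (Phi t p) ord0 i.
have fT s : `|s| < e -> f (T s) = crd c p ord0 i.
  move=> se; have [[q cq qs] _] := He s se.
  rewrite /f HT // -qs crdK // qs !mxE.
  by rewrite eqxx (negPf (_ : i != j)) ?mulr0 ?addr0 // eq_sym.
have /choice[N HN] s : exists n : nat, `|s| < e ->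
    forall t, `|t - T s| < n.+1%:R^-1 -> f t = f (T s) -> t = T s.
  have [se|se] := boolP (`|s| < e); last by exists 0%N.
  have [[q cq qs] [_ Xs]] := He s se.
  suff df : is_derive (T s) (1 : R) f (X c (icrd c (seg s)) ord0 i).
    have fd : derivable f (T s) 1 by case: df.
    have fn : 'D_1 f (T s) != 0 by rewrite derive_val.
    by have [n Hn] := derivable_level_isolated fd fn; exists n.
  have Pq : Phi (T s) p = q by rewrite HT // -qs crdK.
  have := (Phi_flow p).2 (T s) c; rewrite Pq => /(_ cq).
  rewrite -qs crdK //.
  move=> [dPhi PhiD]; split; first exact: (derivable_mxP _ _ _).1 dPhi ord0 i.
  by rewrite -PhiD derive_mx // mxE.
have : countable `]0, e[%classic.
  have lte s : s \in `]0, e[%classic -> `|s| < e.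
    by rewrite inE /= in_itv /= => /andP[s0 se]; rewrite gtr0_norm.
  have /choice[Q HQ] s : exists r : rat, `|ratr r - T s| < (N s).+1%:R^-1 / 2.
    have : T s < T s + (N s).+1%:R^-1 / 2 by rewrite ltrDl divr_gt0.
    move=> /rat_in_itvoo[r]; rewrite in_itv /= => /andP[r1 r2]; exists r.
    by rewrite gtr0_norm ?subr_gt0 // ltrBlDl.
  (* Two parameters with the same code have times less than 1/(N s + 1) apart and on the same level
     of [f]; so the times agree, hence the points of the segment. *)
  apply/countable_injP; exists (fun s => choice.pickle (N s, Q s)).
  move=> s s' /lte se /lte se' /(pcan_inj choice.pickleK) [NN QQ].
  have TT : T s' = T s.
    apply: (HN s se); last by rewrite !fT.
    have := HQ s; have := HQ s'; rewrite -NN -QQ => h1 h2.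
    rewrite -[T s'](subrK (ratr (Q s))) -addrA (le_lt_trans (ler_normD _ _)) //.
    by rewrite [ltRHS]splitr ltrD // distrC.
  have : seg s = seg s'.
    have [[q cq qs] _] := He s se; have [[q' cq' qs'] _] := He s' se'.
    have := HT s se; rewrite -TT HT // -qs -qs' !crdK // => ->; done.
  by move=> /addrI/rowP/(_ j); rewrite !mxE !eqxx !mulr1.
exact: itv_uncountable.
Qed.

Lemma derive_line (f : V -> R) (y w : V) (s : R) :
  derivable f (y + s *: w) w ->
  derivable (fun s : R => f (y + s *: w)) s 1 /\
  'D_1 (fun s : R => f (y + s *: w)) s = 'D_w f (y + s *: w).
Proof.
have E : (fun k : R => k^-1 *: (((fun s : R => f (y + s *: w)) \o shift s) (k *: (1 : R))
             - f (y + s *: w))) =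
    (fun k : R => k^-1 *: ((f \o shift (y + s *: w)) (k *: w) - f (y + s *: w))).
  apply/funext => k /=; congr (_ *: (f _ - _)).
  by rewrite [k *: 1]mulr1 scalerDl addrCA.
by rewrite /derivable /derive E.
Qed.

End Orbits.

(** * Contradiction on a chart segment from a fibre over [S] to a point with h > 0 *)

Theorem proposition4 (R : realType) (M : manifold7 R)
  (theta : kform M 1) (omega : kform M 2) (ReU ImU : kform M 3)
  (xi : vfield M) (Phi : flow M) (S : set (leaf_space Phi)) (h : M -> R)
  (M_CY : contact_calabi_yau theta omega ReU ImU)
  (xi_reeb : reeb theta omega ReU ImU xi)
  (Phi_flow : flow_of xi Phi)
  (orbits_compact : forall p : M, compact (flow_orbit Phi p))
  (S_nonempty : S !=set0)
  (S_discrete : S `<=` isolated S)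
  (h_ge0 : forall p : M, 0 <= h p)
  (h_continuous : continuous h)
  (h_invariant : forall (t : R) (p : M), h (Phi t p) = h p)
  (h_vanishes : forall p : M, h p = 0 <-> S (leaf Phi p))
  (h_smooth : smooth_fun [set p | 0 < h p] h)
  (t1 : M -> R) (t7 : kform M 1) (t14 : kform M 2) (t27 : kform M 3)
  (torsion : G2_torsion [set p | 0 < h p] (ccy_phi h theta omega ReU)
     (ccy_starphi h theta omega ImU) t1 t7 t14 t27) :
  ~ bounded_torsion [set p | 0 < h p] (ccy_phi h theta omega ReU) t1 t7 t14 t27.
Proof.
move=> tor_bounded; have [l Sl] := S_nonempty.
pose p : M := repr l.
have lp : leaf Phi p = l by exact: reprK.
have hp : h p = 0 by apply/h_vanishes; rewrite lp.
have [c cp] := chart_cover p.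
have [L L0 NL] := near_derive_bound M_CY xi_reeb Phi_flow h_invariant h_smooth
  torsion tor_bounded cp.
have FF : Filter (nbhs (crd c p)) by apply: filter_filter.
have Nc : nbhs (crd c p) (crd c @` chart_dom c).
  by apply: near_crd cp _ => q cq; exists q.
have /nbhs_ballP[e /= e0 He] := @filterI _ _ FF _ _ Nc NL.
have [y ey hy] : exists2 y, ball (crd c p) e y & 0 < h (icrd c y).
  apply: contrapT => Hn; apply: (orbit_no_interior (reeb_vfield xi_reeb) Phi_flow cp).
    have [E SE] := ccy_SU3 M_CY cp; rewrite (reeb_frame xi_reeb cp SE).
    have [uE _ _ _ _] := SE; apply/eqP => /(congr1 (mulmx^~ (invmx E))).
    rewrite mulmxK // mul0mx => /rowP/(_ (inord 0)); rewrite stdE // mxE => /eqP.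
    by rewrite oner_eq0.
  (* [U] meets [S] only in [l]; so zeros of [h] near [p] lie on the leaf of [p], and the orbit would
     fill a neighbourhood. *)
  have [_ [U nU US]] := S_discrete _ Sl.
  have NU : \forall x \near crd c p, U (leaf Phi (icrd c x)).
    have lc : {for crd c p, continuous (leaf Phi \o icrd c)}.
      apply: continuous_comp; first exact: icrd_continuous.
      exact: pi_continuous.
    by apply: lc; rewrite /= crdK // lp.
  have NB : nbhs (crd c p) (ball (crd c p) e) by apply: nbhsx_ballx.
  apply: (@filterS _ _ FF _ _ _ (@filterI _ _ FF _ _ NU NB)) => x [Ux ex].
  have hx : h (icrd c x) = 0.
    apply/eqP; rewrite eq_le h_ge0 andbT leNgt; apply/negP => hx.
    by apply: Hn; exists x.
  have : [set l] (leaf Phi (icrd c x)) by rewrite -US; split => //; exact/h_vanishes.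
  rewrite -lp => /esym/eqmodP/asboolP[t _ tx]; by exists t.
pose w := y - crd c p.
pose f s := h (icrd c (crd c p + s *: w)).
have seg s : 0 <= s <= 1 -> ball (crd c p) e (crd c p + s *: w).
  move=> /andP[s0 s1]; move: ey; rewrite -!ball_normE /ball_ /= opprD addNKr normrN.
  rewrite normrZ ger0_norm // distrC; apply: le_lt_trans.
  by rewrite ler_piMl.
(* The ball is convex, so [f' <= L |w| f] holds wherever [f > 0] on the segment; [f 0 = 0], whereas
   [f 1 = h (icrd c y) > 0]. *)
have : f 1 <= 0.
  apply: (@gronwall_zero _ f (L * `|w|)).
  - move=> s /seg/He[[q cq qs] _].
    apply: (@continuous_comp _ _ _ (fun s : R => icrd c (crd c p + s *: w)) h).
      exact: icrd_continuous_at cq (esym qs).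
    exact: h_continuous.
  - move=> s /seg/He[[q cq qs] bd] fs.
    have dq : derivable (h \o icrd c) (crd c p + s *: w) w.
      apply: diff_derivable; rewrite -qs.
      by apply: (smooth_fun_differentiable h_smooth _ cq); move: fs; rewrite /f -qs crdK.
    have [df ->] := derive_line dq; split => //.
    by apply: le_trans (ler_norm _) _; exact: bd.
  - by rewrite /f scale0r addr0 crdK // hp.
by rewrite /f scale1r /w addrC subrK leNgt hy.
Qed.
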